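(* Let $\mathcal{C}$ be a Hurwitz algebra, let $\mathcal{L}=\mathcal{T}(\mathcal{C})$ with its $G=\mathbb{Z}_2^3$-grading $\Gamma_{\mathcal{L}}$, and let $\varepsilon\colon G\times G\to\mathbb{F}$ be a graded contraction of $\Gamma_{\mathcal{L}}$. Then $\varepsilon$ is a generic graded contraction.
   Context: $\mathbb{F}$ is an algebraically closed field of characteristic zero. $G=\mathbb{Z}_2^3$ has elements $g_0=(0,0,0)$, $g_1=(1,0,0)$, $g_2=(0,1,0)$, $g_3=(0,0,1)$, $g_4=(1,1,1)$, $g_5=(1,1,0)$, $g_6=(1,0,1)$, $g_7=(0,1,1)$. Put $I=\{1,\dots,7\}$, $I_0=I\cup\{0\}$, and define $i*j\in I_0$ by $g_i+g_j=g_{i*j}$. Octonions: $\mathcal{O}$ is the $\mathbb{F}$-algebra with basis $e_0=1,e_1,\dots,e_7$, $e_i^2=-1$ ($i\in I$), $e_ie_j=-e_je_i$ for distinct $i,j\in I$, and $e_ie_j=e_k$, $e_je_k=e_i$, $e_ke_i=e_j$ for $(i,j,k)\in\{(1,2,5),(5,6,7),(7,4,1),(1,3,6),(6,4,2),(2,7,3),(4,5,3)\}$. The involution $a\mapsto\bar a$ fixes $e_0$ and negates $e_i$, $i\in I$; the trace $t$ is defined by $t(a)1=a+\bar a$; $\mathcal{O}_0=\{a: t(a)=0\}$; $[a,b]=ab-ba$; $l_a(b)=ab$, $r_a(b)=ba$; $D_{a,b}=[l_a,l_b]+[l_a,r_b]+[r_a,r_b]\in\mathfrak{der}(\mathcal{O})$.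 A Hurwitz algebra $\mathcal{C}$ is one of the subalgebras $\mathcal{F}=\langle e_0\rangle$, $\mathcal{K}=\langle e_0,e_1\rangle$, $\mathcal{H}=\langle e_0,e_1,e_2,e_5\rangle$, $\mathcal{O}$. Given $\mathcal{C}$, $\mathcal{J}=\{u\in\mathcal{M}_3(\mathcal{C}):\bar u^t=u\}$ with product $u\cdot v=\frac12(uv+vu)$, $\mathrm{tr}(u)=\sum_i u_{ii}\in\mathbb{F}$, $\mathcal{J}_0=\{u:\mathrm{tr}(u)=0\}$, $u*v=u\cdot v-\frac13\mathrm{tr}(u\cdot v)1$ on $\mathcal{J}_0$, $R_u(v)=v\cdot u$. Then $\mathcal{L}=\mathcal{T}(\mathcal{C})=\mathfrak{der}(\mathcal{O})\oplus(\mathcal{O}_0\otimes\mathcal{J}_0)\oplus\mathfrak{der}(\mathcal{J})$ is the Lie algebra in which $\mathfrak{der}(\mathcal{O})$, $\mathfrak{der}(\mathcal{J})$ are commuting subalgebras, $[d,a\otimes u]=d(a)\otimes u$, $[D,a\otimes u]=a\otimes D(u)$, and $[a\otimes u,b\otimes v]=\frac13\mathrm{tr}(u\cdot v)D_{a,b}+[a,b]\otimes(u*v)+2t(ab)[R_u,R_v]$ (for $d\in\mathfrak{der}(\mathcal{O})$, $D\in\mathfrak{der}(\mathcal{J})$, $a,b\in\mathcal{O}_0$, $u,v\in\mathcal{J}_0$). The grading $\Gamma_{\mathcal{L}}$ is: $\mathcal{L}_{g_0}=\mathfrak{der}(\mathcal{J})$, and for $i\in I$, $\mathcal{L}_{g_i}=\mathcal{D}_i\oplus(e_i\otimes\mathcal{J}_0)$,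 where $\mathcal{D}_i=\{d\in\mathfrak{der}(\mathcal{O}): d(e_j)\in\mathbb{F}e_{i*j}\ \forall j\in I_0\}$. A graded contraction of $\Gamma_{\mathcal{L}}$ is a map $\varepsilon\colon G\times G\to\mathbb{F}$ such that the vector space $\mathcal{L}$ with the bilinear product $[x,y]^\varepsilon=\varepsilon(g,h)[x,y]$ ($x\in\mathcal{L}_g$, $y\in\mathcal{L}_h$) is a Lie algebra. A map $\varepsilon\colon G\times G\to\mathbb{F}$ is a generic graded contraction if, for all $g,h,k\in G$, $\varepsilon(g,h)=\varepsilon(h,g)$ and $\varepsilon(g,h,k)=\varepsilon(k,g,h)$, where $\varepsilon(g,h,k):=\varepsilon(g,h+k)\varepsilon(h,k)$. *)

(* Defs.v *)
From HB Require Import structures.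
From mathcomp Require Import all_boot all_order all_algebra.

Set Implicit Arguments.
Unset Strict Implicit.
Unset Printing Implicit Defensive.

Import GRing.Theory.
Local Open Scope ring_scope.

Definition Z2cube : zmodType := ('Z_2 * 'Z_2 * 'Z_2)%type.

Definition gelts : seq Z2cube :=
  [:: (0, 0, 0); (1, 0, 0); (0, 1, 0); (0, 0, 1);
      (1, 1, 1); (1, 1, 0); (1, 0, 1); (0, 1, 1)].

(* The index set I_0 = {0, ..., 7} is 'I_8, and I consists of the nonzero
   elements of 'I_8. *)
Definition gel (i : 'I_8) : Z2cube := nth 0 gelts i.

Definition star (i j : 'I_8) : 'I_8 := inord (index (gel i + gel j) gelts).

Lemma gel_bij : bijective gel.
Proof.
exists (fun g => inord (index g gelts)).
  by case=> [[|[|[|[|[|[|[|[|i]]]]]]]] // hi];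
    apply: val_inj; rewrite /= inordK.
case=> [[[[|[|a]] ha] [[|[|b]] hb]] [[|[|c]] hc]] //;
  by rewrite /gel inordK //=; congr (_, _, _); apply: val_inj.
Qed.

Lemma starE i j : gel i + gel j = gel (star i j).
Proof.
have [h _ hK] := gel_bij; rewrite -[LHS]hK /star -[in RHS](hK (_ + _)).
move: (h _) => k; congr gel; apply: val_inj.
by case: k => [[|[|[|[|[|[|[|[|k]]]]]]]] // hk] /=; rewrite inordK.
Qed.

(* Elements of the octonion algebra are coordinate vectors in the basis
   e_0, ..., e_7. *)
Notation oct F := 'rV[F]_8.

Definition e (F : fieldType) (i : 'I_8) : oct F := delta_mx 0 i.
Arguments e {F} i.

Definition olines : seq (nat * nat * nat) :=
  [:: (1, 2, 5); (5, 6, 7); (7, 4, 1); (1, 3, 6); (6, 4, 2); (2, 7, 3);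
      (4, 5, 3)]%N.

(* e_i e_j = e_k *)
Definition opos (i j k : 'I_8) : bool :=
  [|| (val i, val j, val k) \in olines, (val j, val k, val i) \in olines
    | (val k, val i, val j) \in olines].

Definition emul (F : fieldType) (i j : 'I_8) : oct F :=
  if i == ord0 then e j else if j == ord0 then e i
  else if i == j then - e ord0
  else \sum_(k < 8) ((opos i j k)%:R - (opos j i k)%:R) *: e k.
Arguments emul {F} i j.

Definition omul (F : fieldType) (a b : oct F) : oct F :=
  \sum_(i < 8) \sum_(j < 8) (a 0 i * b 0 j) *: emul i j.

Definition oconj (F : fieldType) (a : oct F) : oct F :=
  \row_(i < 8) (if i == ord0 then a 0 i else - a 0 i).

(* a + oconj a is a multiple of e_0 *)
Definition otr (F : fieldType) (a : oct F) : F := (a + oconj a) 0 ord0.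

Definition ocomm (F : fieldType) (a b : oct F) : oct F := omul a b - omul b a.

Definition lie_end (F : fieldType) (V : vectType F) (f g : 'End(V)) : 'End(V) :=
  ((f \o g) - (g \o f))%VF.

Definition is_der (F : fieldType) (V : vectType F) (m : V -> V -> V)
    (d : 'End(V)) : Prop :=
  forall a b, d (m a b) = m (d a) b + m a (d b).

Definition lmulo (F : fieldType) (a : oct F) : 'End(oct F) := linfun (omul a).
Definition rmulo (F : fieldType) (a : oct F) : 'End(oct F) :=
  linfun ((@omul F)^~ a).

Definition Dder (F : fieldType) (a b : oct F) : 'End(oct F) :=
  lie_end (lmulo a) (lmulo b) + lie_end (lmulo a) (rmulo b)
  + lie_end (rmulo a) (rmulo b).

Definition der_comp (F : fieldType) (i : 'I_8) (d : 'End(oct F)) : Prop :=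
  is_der (@omul F) d
  /\ forall j : 'I_8, exists c : F, d (e j) = c *: e (star i j).

Definition hurwitz (F : fieldType) (C : {vspace oct F}) : Prop :=
  C \in [:: <<[:: e ord0]>>%VS;
            <<[:: e ord0; e (inord 1)]>>%VS;
            <<[:: e ord0; e (inord 1); e (inord 2); e (inord 5)]>>%VS;
            fullv].

(* 3 x 3 matrices with octonion entries, indexed by pairs so as to inherit the
   vector space structure over F. *)
Notation mat3 F := {ffun 'I_3 * 'I_3 -> oct F}.

Definition mmul (F : fieldType) (u v : mat3 F) : mat3 F :=
  [ffun p => \sum_(k < 3) omul (u (p.1, k)) (v (k, p.2))].

Definition mconjt (F : fieldType) (u : mat3 F) : mat3 F :=
  [ffun p => oconj (u (p.2, p.1))].

Definition mone (F : fieldType) : mat3 F :=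
  [ffun p => if p.1 == p.2 then e ord0 else 0].

(* Diagonal entries of Hermitian matrices are multiples of e_0; the scalar is
   read off as the coordinate along e_0. *)
Definition mtr (F : fieldType) (u : mat3 F) : F :=
  \sum_(i < 3) (u (i, i)) 0 ord0.

Definition mat3_over (F : fieldType) (C : {vspace oct F}) : {vspace mat3 F} :=
  (\bigcap_(p : 'I_3 * 'I_3) (linfun (fun u : mat3 F => u p) @^-1: C))%VS.

Definition hermitian (F : fieldType) (C : {vspace oct F}) : {vspace mat3 F} :=
  (mat3_over C :&: fixedSpace (linfun (@mconjt F)))%VS.

Notation jalg C := (subvs_of (hermitian C)).

(* vsproj is only used to retype elements: see jmulE and joneE. *)
Definition jmul (F : fieldType) (C : {vspace oct F}) (u v : jalg C) : jalg C :=
  vsproj (hermitian C)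
    (2%:R^-1 *: (mmul (vsval u) (vsval v) + mmul (vsval v) (vsval u))).

Definition jone (F : fieldType) (C : {vspace oct F}) : jalg C :=
  vsproj (hermitian C) (mone F).

Definition jtr (F : fieldType) (C : {vspace oct F}) (u : jalg C) : F :=
  mtr (vsval u).

Definition jstar (F : fieldType) (C : {vspace oct F}) (u v : jalg C) : jalg C :=
  jmul u v - (3%:R^-1 * jtr (jmul u v)) *: jone C.

Definition Rop (F : fieldType) (C : {vspace oct F}) (u : jalg C) :
    'End(jalg C) := linfun (fun v => jmul v u).

(* The tensor product of the octonions with V, as V-valued coordinate families
   on the basis e_0, ..., e_7. *)
Notation otens V := {ffun 'I_8 -> V}.

Definition tens (F : fieldType) (V : vectType F) (a : oct F) (u : V) :
    otens V := [ffun i => a 0 i *: u].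

Definition tens0 (F : fieldType) (C : {vspace oct F})
    (T : otens (jalg C)) : Prop :=
  exists2 s : seq (oct F * jalg C),
    forall p, p \in s -> otr p.1 = 0 /\ jtr p.2 = 0
    & T = \sum_(p <- s) tens p.1 p.2.

Definition titsA (F : fieldType) (C : {vspace oct F}) : vectType F :=
  ('End(oct F) * otens (jalg C) * 'End(jalg C))%type.

Definition tits (F : fieldType) (C : {vspace oct F}) (x : titsA C) : Prop :=
  [/\ is_der (@omul F) x.1.1, tens0 x.1.2 & is_der (@jmul F C) x.2].

(* The bilinear extension of the defining formulas to the whole ambient space,
   using T = \sum_i e_i (x) T_i; tbracketE recovers them on pure tensors. *)
Definition tbracket (F : fieldType) (C : {vspace oct F}) (x y : titsA C) :
    titsA C :=
  let: (d, T, D) := x in let: (d', T', D') := y in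
  (lie_end d d'
     + \sum_(i < 8) \sum_(j < 8)
         (3%:R^-1 * jtr (jmul (T i) (T' j))) *: Dder (e i) (e j),
   \sum_(i < 8) tens (d (e i)) (T' i) - \sum_(i < 8) tens (d' (e i)) (T i)
     + \sum_(i < 8) tens (e i) (D (T' i)) - \sum_(i < 8) tens (e i) (D' (T i))
     + \sum_(i < 8) \sum_(j < 8)
         tens (ocomm (e i) (e j)) (jstar (T i) (T' j)),
   lie_end D D'
     + \sum_(i < 8) \sum_(j < 8)
         (2%:R * otr (omul (e i) (e j))) *: lie_end (Rop (T i)) (Rop (T' j))).

(* The homogeneous component of degree gel i. *)
Definition tits_comp (F : fieldType) (C : {vspace oct F}) (i : 'I_8)
    (x : titsA C) : Prop :=
  if i == ord0 then
    exists2 D : 'End(jalg C), is_der (@jmul F C) D & x = (0, 0, D)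
  else
    exists d : 'End(oct F), exists u : jalg C,
      [/\ der_comp i d, jtr u = 0 & x = (d, tens (e i) u, 0)].

Definition lie_bracket_on (F : fieldType) (V : lmodType F) (L : V -> Prop)
    (B : V -> V -> V) : Prop :=
  [/\ forall x y, L x -> L y -> L (B x y),
      forall (c : F) x y z, L x -> L y -> L z ->
        B (c *: x + y) z = c *: B x z + B y z
        /\ B z (c *: x + y) = c *: B z x + B z y,
      forall x, L x -> B x x = 0
    & forall x y z, L x -> L y -> L z ->
        B x (B y z) + B y (B z x) + B z (B x y) = 0].

(* As the algebra is the direct sum of its homogeneous components, a bilinear
   map with the prescribed values on homogeneous elements is unique. *)
Definition graded_contraction (F : fieldType) (C : {vspace oct F})
    (eps : Z2cube -> Z2cube -> F) : Prop :=
  exists B : titsA C -> titsA C -> titsA C,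
    lie_bracket_on (@tits F C) B
    /\ forall (i j : 'I_8) x y, tits_comp i x -> tits_comp j y ->
         B x y = eps (gel i) (gel j) *: tbracket x y.

Definition eps3 (F : fieldType) (eps : Z2cube -> Z2cube -> F)
    (g h k : Z2cube) : F := eps g (h + k) * eps h k.

Definition generic_graded_contraction (F : fieldType)
    (eps : Z2cube -> Z2cube -> F) : Prop :=
  forall g h k : Z2cube,
    eps g h = eps h g /\ eps3 eps g h k = eps3 eps k g h.

Section Bilinear.
Variable F : fieldType.

Lemma omul_linear_r (a : oct F) : linear (omul a).
Proof.
move=> c x y; rewrite /omul scaler_sumr -big_split; apply: eq_bigr => i _ /=.
rewrite scaler_sumr -big_split; apply: eq_bigr => j _ /=.
by rewrite !mxE mulrDr scalerDl scalerA mulrCA.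
Qed.

Lemma omul_linear_l (b : oct F) : linear ((@omul F)^~ b).
Proof.
move=> c x y; rewrite /omul scaler_sumr -big_split; apply: eq_bigr => i _ /=.
rewrite scaler_sumr -big_split; apply: eq_bigr => j _ /=.
by rewrite !mxE mulrDl scalerDl scalerA mulrA.
Qed.

Lemma oconj_linear : linear (@oconj F).
Proof.
move=> c x y; apply/rowP => i; rewrite !mxE.
by case: ifP => //; rewrite opprD mulrN.
Qed.

HB.instance Definition _ :=
  GRing.isLinear.Build F (oct F) (oct F) *:%R (@oconj F) oconj_linear.

End Bilinear.

Lemma linfunP (F : fieldType) (U V : vectType F) (f : U -> V) :
  linear f -> linfun f =1 f.
Proof.
move=> lf.
pose g : {linear U -> V} := HB.pack f (GRing.isLinear.Build F U V *:%R f lf).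
exact: (lfunE g).
Qed.

Lemma mconjt_linear (F : fieldType) : linear (@mconjt F).
Proof. by move=> c x y; apply/ffunP => p; rewrite !ffunE linearP. Qed.

Lemma hermitianP (F : fieldType) (C : {vspace oct F}) (u : mat3 F) :
  reflect ((forall p, u p \in C) /\ mconjt u = u) (u \in hermitian C).
Proof.
have hp p : linear (fun u : mat3 F => u p) by move=> c x y; rewrite !ffunE.
have hM : (u \in mat3_over C) = [forall p, u p \in C].
  apply/idP/forallP => [h p|h].
    move: (subvP (bigcapv_inf p isT (subvv _)) u h).
    by rewrite -memv_preim linfunP.
  rewrite memvE; apply/subv_bigcapP => p _; rewrite -memvE.
  by rewrite -memv_preim linfunP.
have hc := linfunP (@mconjt_linear F) u.
rewrite memv_cap hM; apply: (iffP andP) => -[].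
  by move=> /forallP h /fixedSpaceP; rewrite hc.
by move=> h1 h2; split; [apply/forallP | apply/fixedSpaceP; rewrite hc].
Qed.

Lemma emul_star (F : fieldType) (i j : 'I_8) :
  exists c : F, emul i j = c *: e (star i j).
Proof.
have star0 k : star ord0 k = k.
  apply: (bij_inj gel_bij).
  by rewrite -starE (_ : gel ord0 = 0) ?add0r.
have starC k l : star k l = star l k by rewrite /star addrC.
rewrite /emul; case: eqP => [->|_]; first by exists 1; rewrite star0 scale1r.
case: eqP => [->|_]; first by exists 1; rewrite starC star0 scale1r.
case: eqP => [->|_].
  exists (-1); rewrite scaleN1r; congr (- e _).
  apply: (bij_inj gel_bij); rewrite -starE.
  by case: j => [[|[|[|[|[|[|[|[|k]]]]]]]] // hk]; apply/eqP.
have hop (a b k : 'I_8) : opos a b k -> k = star a b.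
  move=> h; apply/(bij_inj gel_bij)/eqP; rewrite -starE; move: h.
  rewrite /opos /olines.
  by case: a => [[|[|[|[|[|[|[|[|a]]]]]]]] // ha];
     case: b => [[|[|[|[|[|[|[|[|b]]]]]]]] // hb];
     case: k => [[|[|[|[|[|[|[|[|k]]]]]]]] // hk].
exists ((opos i j (star i j))%:R - (opos j i (star i j))%:R).
rewrite (bigD1 (star i j)) //= big1 ?addr0 // => k nk.
case hk: (opos i j k); first by rewrite (hop _ _ _ hk) eqxx in nk.
case hk': (opos j i k); first by rewrite (hop _ _ _ hk') starC eqxx in nk.
by rewrite subrr scale0r.
Qed.

Lemma hurwitz_span (F : fieldType) (C : {vspace oct F}) : hurwitz C ->
  exists X : seq 'I_8,
    [/\ ord0 \in X, C = <<map e X>>%VS & {in X &, forall i j, star i j \in X}].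
Proof.
have h0 i : star i i = ord0.
  apply: (bij_inj gel_bij); rewrite -starE; apply/eqP.
  by case: i => [[|[|[|[|[|[|[|[|k]]]]]]]] // hk].
rewrite /hurwitz !inE => /or4P[] /eqP ->.
- by exists [:: ord0]; split=> // i j; rewrite !inE => /eqP-> /eqP->; rewrite h0.
- exists [:: ord0; inord 1]; split=> // i j; rewrite !inE.
  by case/orP=> /eqP-> /orP[]/eqP->; apply/orP; rewrite ?h0; [left|right|right|left];
    rewrite // -(inj_eq (bij_inj gel_bij)) -starE /gel ?inordK.
- exists [:: ord0; inord 1; inord 2; inord 5]; split=> // i j.
  rewrite !inE -!(inj_eq (bij_inj gel_bij)) -starE /gel ?inordK //.
  by case/or4P=> /eqP-> /or4P[]/eqP->.
- exists (enum 'I_8); split=> [||i j _ _]; rewrite ?mem_enum //.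
  apply/vspaceP => a; rewrite memvf; symmetry.
  rewrite [a]row_sum_delta; apply: memv_suml => i _; apply: memvZ.
  by apply/memv_span/mapP; exists i; rewrite ?mem_enum.
Qed.

Lemma lin_coord (F : fieldType) (V : lmodType F) (f : oct F -> V) a :
  linear f -> f a = \sum_(i < 8) a 0 i *: f (e i).
Proof.
move=> lf.
pose g : {linear oct F -> V} :=
  HB.pack f (GRing.isLinear.Build F (oct F) V *:%R f lf).
rewrite [in LHS](row_sum_delta a) -[f]/(g : _ -> _) linear_sum.
by apply: eq_bigr => i _; rewrite linearZ.
Qed.

Lemma omul_e (F : fieldType) i j : omul (e i) (e j) = emul i j :> oct F.
Proof.
rewrite /omul (bigD1 i) //= [X in _ + X]big1 ?addr0 => [|k nk]; last first.
  by rewrite big1 // => l _; rewrite !mxE (negbTE nk) andbF mul0r scale0r.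
rewrite (bigD1 j) //= big1 ?addr0 => [|k nk].
  by rewrite !mxE !eqxx mulr1 scale1r.
by rewrite !mxE (negbTE nk) andbF mulr0 scale0r.
Qed.

Lemma omul_span (F : fieldType) (C : {vspace oct F}) a b :
  hurwitz C -> a \in C -> b \in C -> omul a b \in C.
Proof.
case/hurwitz_span => X [_ -> cl].
have hs (c : oct F) : c \in <<map e X>>%VS -> forall i, i \notin X -> c 0 i = 0.
  move=> hc i hi; pose f (x : oct F) : F^o := x 0 i.
  have: (<<map e X>> <= lker (linfun f))%VS.
    apply/span_subvP => _ /mapP[j jX ->].
    rewrite memv_ker linfunP; first by rewrite /f mxE; case: (i =P j) hi => [->|]; rewrite ?jX ?andbF.
    by move=> k x y; rewrite /f !mxE.
  move/subvP/(_ _ hc); rewrite memv_ker linfunP; first by move/eqP.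
  by move=> k x y; rewrite /f !mxE.
move=> /hs ha /hs hb; rewrite /omul.
apply: memv_suml => i _; apply: memv_suml => j _.
case hi: (i \in X); last by rewrite ha ?hi // mul0r scale0r mem0v.
case hj: (j \in X); last by rewrite hb ?hj // mulr0 scale0r mem0v.
have [c ->] := emul_star F i j.
by do 2!apply: memvZ; apply: memv_span; apply: map_f; apply: cl.
Qed.

Lemma emul_conj (F : fieldType) i j :
  oconj (emul i j) = omul (oconj (e j)) (oconj (e i)) :> oct F.
Proof.
have o0 (a b : 'I_8) : opos a b ord0 = false.
  by case: a => [[|[|[|[|[|[|[|[|a]]]]]]]] // ha];
     case: b => [[|[|[|[|[|[|[|[|b]]]]]]]] // hb].
have he k : oconj (e k) = (if k == ord0 then 1 else -1) *: e k :> oct F.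
  apply/rowP => l; rewrite !mxE eqxx /=.
  case: (l =P k) => [->|_]; first by case: ifP; rewrite ?mulr1 ?mul1r.
  by rewrite mulr0 oppr0; case: ifP.
have z a b : forall c d : F, omul (c *: a) (d *: b) = (c * d) *: omul a b.
  move=> c d; have := omul_linear_r (c *: a) d b 0; rewrite !addr0.
  have h0 x : omul x 0 = 0 :> oct F.
    by rewrite /omul big1 // => k _; rewrite big1 // => l _; rewrite mxE mulr0 scale0r.
  have h1 x : omul 0 x = 0 :> oct F.
    by rewrite /omul big1 // => k _; rewrite big1 // => l _; rewrite mxE mul0r scale0r.
  rewrite h0 addr0 => ->; have := omul_linear_l b c a 0; rewrite h1 !addr0 => ->.
  by rewrite scalerA mulrC.
rewrite !he z omul_e /emul.
have [->|ni] := eqVneq i ord0; first by rewrite /= he mulr1; case: (j =P ord0) => [->|].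
have [_|nj] := eqVneq j ord0; first by rewrite he (negbTE ni) mul1r.
rewrite mulrNN mulr1 scale1r [j == i]eq_sym; case: (i =P j) => [_|_].
  by rewrite linearN /= he scale1r.
rewrite linear_sum; apply: eq_bigr => k _; rewrite linearZ /= he.
case: (k =P ord0) => [->|_]; last by rewrite scaleN1r scalerN -scaleNr opprB.
by rewrite !o0 subrr !scale0r ?scaler0.
Qed.

Lemma oconj_mul (F : fieldType) (a b : oct F) :
  oconj (omul a b) = omul (oconj b) (oconj a).
Proof.
have l1 x : linear (fun a : oct F => oconj (omul a x)).
  by move=> c u v; rewrite omul_linear_l linearP.
have l2 x : linear (fun b : oct F => oconj (omul x b)).
  by move=> c u v; rewrite omul_linear_r linearP.
have l3 x : linear (fun a : oct F => omul (oconj x) (oconj a)).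
  by move=> c u v; rewrite linearP omul_linear_r.
have l4 x : linear (fun b : oct F => omul (oconj b) (oconj x)).
  by move=> c u v; rewrite linearP omul_linear_l.
rewrite (lin_coord _ (l1 b)) (lin_coord _ (l3 b)); apply: eq_bigr => i _.
rewrite (lin_coord _ (l2 _)) (lin_coord _ (l4 _)); congr (_ *: _).
by apply: eq_bigr => j _; rewrite omul_e emul_conj.
Qed.

Lemma mmul_conjt (F : fieldType) (u v : mat3 F) :
  mconjt (mmul u v) = mmul (mconjt v) (mconjt u).
Proof.
apply/ffunP => p; rewrite !ffunE linear_sum; apply: eq_bigr => k _.
by rewrite !ffunE /= oconj_mul.
Qed.

Lemma jmulE (F : fieldType) (C : {vspace oct F}) (u v : jalg C) :
  hurwitz C ->
  vsval (jmul u v) =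
    2%:R^-1 *: (mmul (vsval u) (vsval v) + mmul (vsval v) (vsval u)).
Proof.
move=> hC; rewrite vsprojK //; apply: memvZ.
have [hu hu'] := hermitianP _ _ (subvsP u).
have [hv hv'] := hermitianP _ _ (subvsP v).
apply/hermitianP; split=> [p|].
  rewrite !ffunE; apply: memvD; apply: memv_suml => k _; exact: omul_span.
have -> (x y : mat3 F) : mconjt (x + y) = mconjt x + mconjt y.
  by have := mconjt_linear 1 x y; rewrite !scale1r.
by rewrite !mmul_conjt hu' hv' addrC.
Qed.

Lemma joneE (F : fieldType) (C : {vspace oct F}) :
  hurwitz C -> vsval (jone C) = mone F.
Proof.
case/hurwitz_span => X [h0 hC _]; rewrite vsprojK //.
apply/hermitianP; split=> [p|].
  rewrite ffunE; case: eqP => _; last exact: mem0v.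
  by rewrite hC memv_span ?map_f.
apply/ffunP => p; rewrite !ffunE /= eq_sym; case: eqP => _; last exact: linear0.
by apply/rowP => i; rewrite !mxE; case: eqP => // _; rewrite oppr0.
Qed.

Section Tens.
Variables (F : fieldType) (V : vectType F).
Implicit Types (a : oct F) (u : V).

Lemma tens_linear_l u : linear (fun a => tens a u).
Proof. by move=> c a b; apply/ffunP => i; rewrite !ffunE !mxE scalerDl scalerA. Qed.

Lemma tens_linear_r a : linear (fun u => tens a u).
Proof.
by move=> c u v; apply/ffunP => i; rewrite !ffunE scalerDr !scalerA mulrC.
Qed.

Lemma otens_sum (T : otens V) : T = \sum_(i < 8) tens (e i) (T i).
Proof.
apply/ffunP => j; rewrite sum_ffunE (bigD1 j) //= big1 => [|i ni].
  by rewrite ffunE mxE !eqxx scale1r addr0.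
by rewrite ffunE mxE eq_sym (negbTE ni) scale0r.
Qed.
End Tens.

Section Alg.
Variables (F : fieldType) (C : {vspace oct F}).
Implicit Types u v w : jalg C.

Lemma jmulC u v : jmul u v = jmul v u.
Proof. by rewrite /jmul addrC. Qed.

Lemma jmul_linear u : linear (fun v => jmul u v).
Proof.
move=> c v w; have E : vsval (c *: v + w) = c *: vsval v + vsval w by [].
rewrite /jmul E -[RHS](linearP (vsproj (hermitian C))); congr (vsproj (hermitian C) _).
rewrite scalerA mulrC -scalerA -scalerDr; congr (_ *: _).
rewrite scalerDr addrACA; congr (_ + _); apply/ffunP => p; rewrite !ffunE.
  rewrite scaler_sumr -big_split; apply: eq_bigr => k _ /=.
  by rewrite !ffunE omul_linear_r.
rewrite scaler_sumr -big_split; apply: eq_bigr => k _ /=.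
by rewrite !ffunE omul_linear_l.
Qed.

Lemma jtr_linear : linear (@jtr F C : jalg C -> F^o).
Proof.
move=> c u v; rewrite /jtr /mtr linearP scaler_sumr -big_split.
by apply: eq_bigr => k _; rewrite !ffunE !mxE.
Qed.

Lemma RopE u v : Rop u v = jmul v u.
Proof. rewrite linfunP // => c x y; rewrite !(jmulC _ u); exact: jmul_linear. Qed.

Lemma lie_endE (W : vectType F) (f g : 'End(W)) x :
  lie_end f g x = f (g x) - g (f x).
Proof. by rewrite /lie_end add_lfunE opp_lfunE !comp_lfunE. Qed.

Lemma lmuloE (a b : oct F) : lmulo a b = omul a b.
Proof. exact/linfunP/omul_linear_r. Qed.

Lemma rmuloE (a b : oct F) : rmulo a b = omul b a.
Proof. exact: (linfunP (@omul_linear_l F a)). Qed.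
End Alg.

Lemma linear_0 (F : fieldType) (U V : lmodType F) (f : U -> V) :
  linear f -> f 0 = 0.
Proof. by move=> h; have := h (-1) 0 0; rewrite !scaleN1r oppr0 addr0 addNr. Qed.

Lemma linear_Z (F : fieldType) (U V : lmodType F) (f : U -> V) c x :
  linear f -> f (c *: x) = c *: f x.
Proof. by move=> h; have := h c x 0; rewrite (linear_0 h) !addr0. Qed.

Lemma bilin_coord (F : fieldType) (W : lmodType F) (f : oct F -> oct F -> W) a b :
  (forall x, linear (f x)) -> (forall y, linear (fun x => f x y)) ->
  f a b = \sum_(i < 8) \sum_(j < 8) (a 0 i * b 0 j) *: f (e i) (e j).
Proof.
move=> hr hl; rewrite (lin_coord a (hl b)); apply: eq_bigr => i _.
rewrite (lin_coord b (hr (e i))) scaler_sumr.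
by apply: eq_bigr => j _; rewrite scalerA.
Qed.

Section Brk.
Variables (F : fieldType) (C : {vspace oct F}).
Implicit Types (u v : jalg C) (a b : oct F) (d : 'End(oct F)) (D : 'End(jalg C)).

Lemma lie_end_linear_r (W : vectType F) (f : 'End(W)) :
  linear (fun g => lie_end f g).
Proof.
move=> c x y; apply/lfunP => z; rewrite !(lie_endE, add_lfunE, scale_lfunE).
by rewrite linearP opprD addrACA scalerBr.
Qed.

Lemma lie_end_linear_l (W : vectType F) (g : 'End(W)) :
  linear (fun f => lie_end f g).
Proof.
move=> c x y; apply/lfunP => z; rewrite !(lie_endE, add_lfunE, scale_lfunE).
by rewrite linearP opprD addrACA scalerBr.
Qed.

Lemma lmulo_linear : linear (@lmulo F).
Proof.
move=> c a b; apply/lfunP => x; rewrite add_lfunE scale_lfunE !lmuloE.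
exact: omul_linear_l.
Qed.

Lemma rmulo_linear : linear (@rmulo F).
Proof.
move=> c a b; apply/lfunP => x; rewrite add_lfunE scale_lfunE !rmuloE.
exact: omul_linear_r.
Qed.

Lemma Rop_linear : linear (@Rop F C).
Proof.
move=> c a b; apply/lfunP => x; rewrite add_lfunE scale_lfunE !RopE.
exact: jmul_linear.
Qed.

Lemma Dder_linear_r a : linear (fun b => Dder a b).
Proof.
move=> c x y; rewrite /Dder lmulo_linear rmulo_linear !lie_end_linear_r.
by rewrite !scalerDr [RHS]addrACA; congr (_ + _); exact: addrACA.
Qed.

Lemma Dder_linear_l b : linear (fun a => Dder a b).
Proof.
move=> c x y; rewrite /Dder lmulo_linear rmulo_linear !lie_end_linear_l.
by rewrite !scalerDr [RHS]addrACA; congr (_ + _); exact: addrACA.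
Qed.

Lemma ocomm_linear_r a : linear (fun b => ocomm a b).
Proof.
move=> c x y; rewrite /ocomm omul_linear_r omul_linear_l.
by rewrite opprD addrACA scalerBr.
Qed.

Lemma ocomm_linear_l b : linear (fun a => ocomm a b).
Proof.
move=> c x y; rewrite /ocomm omul_linear_r omul_linear_l.
by rewrite opprD addrACA scalerBr.
Qed.

Lemma otr_linear : linear (@otr F : oct F -> F^o).
Proof. by move=> c x y; rewrite /otr !mxE /= -[RHS]/(c * _ + _) mulrDr addrACA. Qed.

Lemma jstar_linear u : linear (fun v => jstar u v).
Proof.
move=> c x y; rewrite /jstar jmul_linear.
have -> : jtr (c *: jmul u x + jmul u y) = c * jtr (jmul u x) + jtr (jmul u y).
  exact: jtr_linear.
by rewrite mulrDr scalerDl opprD addrACA scalerBr scalerA mulrCA.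
Qed.

Lemma jstarC u v : jstar u v = jstar v u.
Proof. by rewrite /jstar jmulC. Qed.

Lemma sum_tens (V : vectType F) (W : vectType F) (f : oct F -> V -> W) a (u : V) :
  (forall x, linear (f x)) -> (forall y, linear (fun x => f x y)) ->
  \sum_(i < 8) f (e i) (tens a u i) = f a u.
Proof.
move=> hr hl; rewrite (lin_coord a (hl u)).
by apply: eq_bigr => i _; rewrite ffunE (linear_Z _ _ (hr _)).
Qed.

Lemma sum_tens0 (V : vectType F) (W : vectType F) (f : oct F -> V -> W) :
  (forall x, linear (f x)) ->
  \sum_(i < 8) f (e i) ((0 : otens V) i) = 0.
Proof. by move=> hr; rewrite big1 // => i _; rewrite ffunE (linear_0 (hr _)). Qed.
End Brk.

Section Brk2.
Variables (F : fieldType) (C : {vspace oct F}).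
Implicit Types (u v : jalg C) (a b : oct F) (d : 'End(oct F)) (D : 'End(jalg C)).

Lemma tens0P (T : otens (jalg C)) : [pchar F] =i pred0 ->
  tens0 T <-> T ord0 = 0 /\ forall i, jtr (T i) = 0.
Proof.
move=> ch; have n2 : 2%:R != 0 :> F by rewrite (pcharf0P F).1.
have hj := @jtr_linear F C; split=> [[s hs ->]|[T0 hT]].
  have s0 p : p \in s -> p.1 0 ord0 = 0.
    move=> /hs[+ _]; rewrite /otr !mxE /= -mulr2n -mulr_natl => /eqP.
    by rewrite mulf_eq0 (negbTE n2) => /eqP.
  split=> [|i]; rewrite sum_ffunE.
    by rewrite big_seq big1 // => p ps; rewrite ffunE s0 // scale0r.
  elim: s hs {s0} => [|p s IH] hs; first by rewrite big_nil (linear_0 hj).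
  rewrite big_cons ffunE (hj _ _ _) (hs p _).2 ?mem_head // scaler0 add0r IH //.
  by move=> q qs; apply: hs; rewrite inE qs orbT.
exists [seq (e i, T i) | i <- enum 'I_8 & i != ord0].
  move=> p /mapP[i]; rewrite mem_filter => /andP[ni _] -> /=; split=> //.
  by rewrite /otr !mxE eqxx [_ == i]eq_sym (negbTE ni) addr0.
rewrite big_map big_filter big_enum_cond /= [T in LHS]otens_sum (bigD1 ord0) //= T0.
by rewrite (linear_0 (tens_linear_r _)) add0r.
Qed.

Lemma tbracketE d d' a b u v D D' :
  tbracket (d, tens a u, D) (d', tens b v, D') =
  (lie_end d d' + (3%:R^-1 * jtr (jmul u v)) *: Dder a b,
   tens (d b) v - tens (d' a) u + tens b (D v) - tens a (D' u)
     + tens (ocomm a b) (jstar u v),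
   lie_end D D' + (2%:R * otr (omul a b)) *: lie_end (Rop u) (Rop v)) :> titsA C.
Proof.
have hj i j : jmul (tens a u i) (tens b v j) = (a 0 i * b 0 j) *: jmul u v.
  rewrite !ffunE (linear_Z _ _ (jmul_linear _)) jmulC.
  by rewrite (linear_Z _ _ (jmul_linear _)) jmulC scalerA mulrC.
have hs i j : jstar (tens a u i) (tens b v j) = (a 0 i * b 0 j) *: jstar u v.
  rewrite !ffunE (linear_Z _ _ (jstar_linear _)) jstarC.
  by rewrite (linear_Z _ _ (jstar_linear _)) jstarC scalerA mulrC.
have hd (f : 'End(oct F)) x (w : jalg C) :
    \sum_(i < 8) tens (f (e i)) (tens x w i) = tens (f x) w.
  apply: (sum_tens (f := fun y z => tens (f y) z)) => [y c z z'|y c z z'].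
    exact: tens_linear_r.
  by rewrite linearP tens_linear_l.
have hD (f : 'End(jalg C)) x (w : jalg C) :
    \sum_(i < 8) tens (e i) (f (tens x w i)) = tens x (f w).
  apply: (sum_tens (f := fun y z => tens y (f z))) => [y c z z'|y c z z'].
    by rewrite linearP tens_linear_r.
  exact: tens_linear_l.
rewrite /tbracket !hd !hD; congr (_ + _, _ + _, _ + _).
- rewrite (bilin_coord a b (@Dder_linear_r F) (@Dder_linear_l F)) scaler_sumr.
  apply: eq_bigr => i _; rewrite scaler_sumr; apply: eq_bigr => j _.
  rewrite hj (linear_Z _ _ (@jtr_linear F C)) scalerA; congr (_ *: _).
  by rewrite -mulrA; congr (_ * _); exact: mulrC.
- rewrite (bilin_coord (f := fun x y => tens (ocomm x y) (jstar u v)) a b).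
  + apply: eq_bigr => i _; apply: eq_bigr => j _.
    by rewrite hs (linear_Z _ _ (tens_linear_r _)).
  + by move=> x c y z; rewrite ocomm_linear_r tens_linear_l.
  + by move=> x c y z; rewrite ocomm_linear_l tens_linear_l.
- have -> : otr (omul a b) =
      \sum_(i < 8) \sum_(j < 8) (a 0 i * b 0 j) * otr (omul (e i) (e j)).
    apply: (bilin_coord (f := fun x y => otr (omul x y) : F^o) a b).
      by move=> x c y z; rewrite omul_linear_r otr_linear.
    by move=> x c y z; rewrite omul_linear_l otr_linear.
  rewrite mulr_sumr scaler_suml; apply: eq_bigr => i _.
  rewrite mulr_sumr scaler_suml; apply: eq_bigr => j _.
  rewrite !ffunE !(linear_Z _ _ (@Rop_linear F C)).
  rewrite (linear_Z _ _ (lie_end_linear_r _)) (linear_Z _ _ (lie_end_linear_l _)).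
  rewrite !scalerA; congr (_ *: _).
  by rewrite -!mulrA; congr (_ * _); rewrite [RHS]mulrA [RHS]mulrC [a 0 i * _]mulrC.
Qed.
End Brk2.

(* Main.v *)
(** Let x, y, z be homogeneous of degrees g, h, k with [x, y] = 0.  The Jacobi
    identities of [,] and of the contracted bracket give
      (eps3 g h k - eps3 h k g) [x, [y, z]] = 0,
    so it suffices to find, in every triple of degrees, such x, y, z with
    [x, [y, z]] <> 0.  They can be taken uniformly in C: for a 3 x 3 integer
    matrix A, use e_i (x) A (A symmetric of trace 0) in degree g_i, i in I, and
    the derivation ad A (A skew) in degree g_0.  On such elements, provided that
    tr (AB) = 0, the bracket is, up to a sign, the commutator or the
    anticommutator of A and B placed in degree i * j, so the 512 cases are a
    finite computation with integer matrices.  The symmetry of eps follows in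
    the same way from [y, z] <> 0. *)

From HB Require Import structures.
Require Import Defs.
From mathcomp Require Import all_boot all_order all_algebra ring zify.

Set Implicit Arguments.
Unset Strict Implicit.
Unset Printing Implicit Defensive.

Import GRing.Theory.
Local Open Scope ring_scope.

(** * Computable model of the bracket on integer matrices, and the witnesses *)

(* Lists rather than 'M[int]_3, whose operations do not reduce. *)
Definition imx := seq (seq int).
Definition ient (A : imx) (p q : nat) : int := nth 0 (nth [::] A p) q.
Definition imk (f : nat -> nat -> int) : imx :=
  [seq [seq f p q | q <- iota 0 3] | p <- iota 0 3].

Definition imul (A B : imx) : imx := imk (fun p q =>
  ient A p 0 * ient B 0 q + ient A p 1 * ient B 1 q + ient A p 2 * ient B 2 q).
Definition isub (A B : imx) : imx := imk (fun p q => ient A p q - ient B p q).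
Definition iadd (A B : imx) : imx := imk (fun p q => ient A p q + ient B p q).
Definition iscale (c : int) (A : imx) : imx := imk (fun p q => c * ient A p q).
Definition itrans (A : imx) : imx := imk (fun p q => ient A q p).
Definition itr (A : imx) : int := ient A 0 0 + ient A 1 1 + ient A 2 2.
Definition idiag (a b c : int) : imx := [:: [:: a; 0; 0]; [:: 0; b; 0]; [:: 0; 0; c]].
Definition izero : imx := idiag 0 0 0.

(* [star] itself does not reduce, because of [inord]. *)
Definition nstar (i j : nat) : nat :=
  nth 0%N (nth [::]
    [:: [:: 0; 1; 2; 3; 4; 5; 6; 7];
      [:: 1; 0; 5; 6; 7; 2; 3; 4];
      [:: 2; 5; 0; 7; 6; 1; 4; 3];
      [:: 3; 6; 7; 0; 5; 4; 1; 2];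
      [:: 4; 7; 6; 5; 0; 3; 2; 1];
      [:: 5; 2; 1; 4; 3; 0; 7; 6];
      [:: 6; 3; 4; 1; 2; 7; 0; 5];
      [:: 7; 4; 3; 2; 1; 6; 5; 0]]%N i) j.

Definition nopos (i j k : nat) : bool :=
  [|| (i, j, k) \in olines, (j, k, i) \in olines | (k, i, j) \in olines].

(** The pairs for which $e_i$ and $e_j$ commute: the bracket is then governed by the commutator of
    the matrices, and by their anticommutator otherwise. *)
Definition skewdeg (i j : nat) : bool := [|| i == 0, j == 0 | i == j]%N.

Definition isign (i j : nat) : int :=
  if (i == 0)%N || (j == 0)%N then 1 else if i == j then -1
  else (nopos i j (nstar i j))%:Z - (nopos j i (nstar i j))%:Z.

(* The bracket of [phi i A] and [phi j B]: see [tbracket_phi]. *)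
Definition ibr (i j : nat) (A B : imx) : imx :=
  let AB := imul A B in let BA := imul B A in
  iscale (isign i j) (if skewdeg i j then isub AB BA else iadd AB BA).

Definition imx_deg (i : nat) (A : imx) : bool :=
  (itrans A == iscale (if i == 0%N then -1 else 1) A) && (itr A == 0).

(** The trace of $AB$ is the coefficient of both the $D_{a,b}$ term and the correction term in $u *
    v$; its vanishing keeps the bracket inside the model. Neither term occurs when a factor has
    degree $g_0$. *)
Definition ibr_ok (i j : nat) (A B : imx) : bool :=
  [&& imx_deg i A, imx_deg j B & [|| i == 0%N, j == 0%N | itr (imul A B) == 0]].

(** For distinct indices, [c] selects the symmetry type: symmetric for 1, skew for -1. *)
Definition iE (a b : nat) (c : int) : imx := imk (fun p q =>
  if (p == a) && (q == b) then 1 else if (p == b) && (q == a) then c else 0).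

(* [wx i j], [wy i j], [wz k] are the commuting pair and the third element for
   the triple of degrees (i, j, k). *)
Definition wx (i j : nat) : imx :=
  if i == 0%N then iE 0 1 (-1) else if j == 0%N then idiag 1 1 (-2%:Z)
  else if i == j then idiag 1 (-1) 0 else iE 0 1 1.
Definition wy (i j : nat) : imx :=
  if j == 0%N then iE 0 1 (-1) else if i == 0%N then idiag 1 1 (-2%:Z)
  else idiag 1 (-1) 0.
Definition wz (k : nat) : imx := if k == 0%N then iE 0 2 (-1) else iE 0 2 1.

(* For i = j the elements x and y coincide, so they commute even though
   tr (AB) = 0, which [tbracket_phi] requires, fails when i <> 0. *)
Definition witness_ok (i j k : nat) : bool :=
  let A := wx i j in let B := wy i j in let C := wz k in
  let BC := ibr j k B C in let CA := ibr k i C A in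
  let ABC := ibr i (nstar j k) A BC in
  [&& ibr_ok j k B C, ibr_ok k j C B, ibr k j C B == iscale (-1) BC,
      BC != izero &
  [&& ibr_ok i (nstar j k) A BC, imx_deg (nstar i (nstar j k)) ABC,
      ABC != izero, ibr_ok k i C A, ibr_ok j (nstar k i) B CA,
      ibr j (nstar k i) B CA == iscale (-1) ABC &
      (i != j) ==> (ibr_ok i j A B && (ibr i j A B == izero))]].

(** The pairs commute because the skew matrix on the first two coordinates commutes with
    [idiag 1 1 (-2)], while the symmetric off-diagonal one anticommutes with [idiag 1 (-1) 0]. The
    third matrix involves the last coordinate, and the double brackets survive. *)
Lemma witness_ok_all :
  all (fun i => all (fun j => all (witness_ok i j) (iota 0 8)) (iota 0 8))
      (iota 0 8).
Proof. by vm_compute. Qed.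

(** * Entries of integer matrices and the group law on indices *)

Lemma ient_imk (f : nat -> nat -> int) (p q : 'I_3) : ient (imk f) p q = f p q.
Proof. by case: p q => [[|[|[|p]]] // ?] [[|[|[|q]]] // ?]. Qed.

Lemma imk_eq0 (f : nat -> nat -> int) :
  (forall p q : 'I_3, f p q = 0) -> imk f = izero.
Proof.
move=> h; rewrite /imk /izero /idiag /=.
have h' p q (hp : (p < 3)%N) (hq : (q < 3)%N) : f p q = 0.
  exact: (h (Ordinal hp) (Ordinal hq)).
by rewrite !h'.
Qed.

Lemma val_star (i j : 'I_8) : star i j = nstar i j :> nat.
Proof.
by case: i => [[|[|[|[|[|[|[|[|i]]]]]]]] // hi];
   case: j => [[|[|[|[|[|[|[|[|j]]]]]]]] // hj]; rewrite /star inordK.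
Qed.

Lemma starA : associative star.
Proof.
move=> i j k; apply: (bij_inj gel_bij).
rewrite -[LHS](starE i (star j k)) -[RHS](starE (star i j) k).
by rewrite -[X in _ + X = _](starE j k) -[X in _ = X + _](starE i j) addrA.
Qed.

Lemma starC : commutative star.
Proof. by move=> i j; apply: (bij_inj gel_bij); rewrite -!starE addrC. Qed.

Lemma star0i j : star ord0 j = j.
Proof. by apply: (bij_inj gel_bij); rewrite -starE (_ : gel ord0 = 0) ?add0r. Qed.

Lemma starii i : star i i = ord0.
Proof.
apply: val_inj; rewrite /= val_star.
by case: i => [[|[|[|[|[|[|[|[|i]]]]]]]] // hi].
Qed.

Local Notation skew A := (itrans A = iscale (-1) A).
Local Notation symm A := (itrans A = iscale 1 A).

Lemma imk_inj (f g : nat -> nat -> int) : imk f = imk g ->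
  forall p q, (p < 3)%N -> (q < 3)%N -> f p q = g p q.
Proof.
move=> h p q hp hq.
by rewrite -[f p q](@ient_imk _ (Ordinal hp) (Ordinal hq)) h ient_imk.
Qed.

Lemma eq_imk (f g : nat -> nat -> int) :
  (forall p q : 'I_3, f p q = g p q) -> imk f = imk g.
Proof.
move=> h; rewrite /imk; apply/eq_in_map => p; rewrite mem_iota => /andP[_ hp].
apply/eq_in_map => q; rewrite mem_iota => /andP[_ hq].
exact: (h (Ordinal hp) (Ordinal hq)).
Qed.

(** Transposition reverses products and $s^2 = 1$, so it exchanges $AB$ and $BA$. *)
Lemma icomm_ianti_sym (s : int) A B : s = 1 \/ s = -1 ->
  itrans A = iscale s A -> itrans B = iscale s B ->
  skew (isub (imul A B) (imul B A)) /\
  symm (iadd (imul A B) (imul B A)).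
Proof.
case=> -> /imk_inj kA /imk_inj kB; split; apply: eq_imk => p q; rewrite !ient_imk;
(* The symmetry of [A] and [B] expresses columns p and q through rows p and q, which leaves a
   polynomial identity. *)
have := (kA p 0 (ltn_ord p) isT, kA p 1 (ltn_ord p) isT, kA p 2 (ltn_ord p) isT)%N;
have := (kA q 0 (ltn_ord q) isT, kA q 1 (ltn_ord q) isT, kA q 2 (ltn_ord q) isT)%N;
have := (kB p 0 (ltn_ord p) isT, kB p 1 (ltn_ord p) isT, kB p 2 (ltn_ord p) isT)%N;
have := (kB q 0 (ltn_ord q) isT, kB q 1 (ltn_ord q) isT, kB q 2 (ltn_ord q) isT)%N;
move: (ient A p 0) (ient A p 1) (ient A p 2)
      (ient A q 0) (ient A q 1) (ient A q 2) => a0 a1 a2 a3 a4 a5;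
move: (ient B p 0) (ient B p 1) (ient B p 2)
      (ient B q 0) (ient B q 1) (ient B q 2) => b0 b1 b2 b3 b4 b5;
move=> [[-> ->] ->] [[-> ->] ->] [[-> ->] ->] [[-> ->] ->]; ring.
Qed.

Lemma itr_mulC A B : itr (imul A B) = itr (imul B A).
Proof. by rewrite /itr /imul /imk /ient /=; ring. Qed.

Lemma itrD A B : itr (iadd A B) = itr A + itr B.
Proof. by rewrite /itr /iadd /imk /ient /=; ring. Qed.

(** * Octonion matrices with entries in the line of $e_0$ *)

Section Octonions.
Variable F : fieldType.
Implicit Types a b x y : oct F.

Lemma lin_sum (U V : lmodType F) (f : U -> V) (n : nat) (g : 'I_n -> U) :
  linear f -> f (\sum_(i < n) g i) = \sum_(i < n) f (g i).
Proof.
move=> lf.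
pose h : {linear U -> V} := HB.pack f (GRing.isLinear.Build F U V *:%R f lf).
exact: (linear_sum h).
Qed.

Lemma omul1l a : omul (e ord0) a = a.
Proof.
rewrite (lin_coord a (omul_linear_r _)) [RHS]row_sum_delta.
by apply: eq_bigr => i _; rewrite omul_e.
Qed.

Lemma omul1r a : omul a (e ord0) = a.
Proof.
rewrite (lin_coord a (@omul_linear_l F _)) [RHS]row_sum_delta.
by apply: eq_bigr => i _; rewrite omul_e /emul; case: eqP => [->|].
Qed.

Lemma omulZl (c : F) a : omul (c *: e ord0) a = c *: a.
Proof. by rewrite (linear_Z _ _ (@omul_linear_l F a)) omul1l. Qed.

Lemma omulZr (c : F) a : omul a (c *: e ord0) = c *: a.
Proof. by rewrite (linear_Z _ _ (@omul_linear_r F a)) omul1r. Qed.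

(** By [emul_star] the product is a multiple of one basis vector, so it suffices to read off that
    coordinate. *)
Lemma emulE (i j : 'I_8) : i != ord0 -> j != ord0 ->
  emul i j = (isign i j)%:~R *: e (star i j) :> oct F.
Proof.
move=> ni nj; have [c hc] := emul_star F i j; rewrite hc; congr (_ *: _).
transitivity ((emul i j : oct F) 0 (star i j)).
  by rewrite hc !mxE !eqxx mulr1.
rewrite /emul /isign -!val_eqE /= in ni nj *.
rewrite -(val_star i j) (negbTE ni) (negbTE nj) /=; case: (eqVneq (val i) (val j)) => hij.
  have -> : star i j = ord0.
    apply: val_inj; rewrite /= val_star -hij.
    by case: i {hc ni hij} => [[|[|[|[|[|[|[|[|i]]]]]]]] // hi].
  by rewrite !mxE !eqxx.
rewrite summxE (bigD1 (star i j)) //= big1 ?addr0 => [|k nk].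
  by rewrite !mxE !eqxx mulr1 rmorphB.
by rewrite !mxE eq_sym (negbTE nk) andbF mulr0.
Qed.

Lemma mmul_linear_r (u : mat3 F) : linear (mmul u).
Proof.
move=> c v w; apply/ffunP => p; rewrite !ffunE scaler_sumr -big_split.
by apply: eq_bigr => k _ /=; rewrite !ffunE omul_linear_r.
Qed.

Lemma mmul_linear_l (u : mat3 F) : linear ((@mmul F)^~ u).
Proof.
move=> c v w; apply/ffunP => p; rewrite !ffunE scaler_sumr -big_split.
by apply: eq_bigr => k _ /=; rewrite !ffunE omul_linear_l.
Qed.

Lemma mmulDr (u v w : mat3 F) : mmul u (v + w) = mmul u v + mmul u w.
Proof. by have := mmul_linear_r u 1 v w; rewrite !scale1r. Qed.
Lemma mmulZr c (u v : mat3 F) : mmul u (c *: v) = c *: mmul u v.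
Proof. exact: (linear_Z _ _ (mmul_linear_r u)). Qed.
Lemma mmulNr (u v : mat3 F) : mmul u (- v) = - mmul u v.
Proof. by rewrite -scaleN1r mmulZr scaleN1r. Qed.
Lemma mmulZl c (u v : mat3 F) : mmul (c *: u) v = c *: mmul u v.
Proof. exact: (linear_Z _ _ (mmul_linear_l v)). Qed.
Lemma mmulDl (u v w : mat3 F) : mmul (v + w) u = mmul v u + mmul w u.
Proof. by have := mmul_linear_l u 1 v w; rewrite !scale1r. Qed.
Lemma mmulNl (u v : mat3 F) : mmul (- v) u = - mmul v u.
Proof. by rewrite -scaleN1r mmulZl scaleN1r. Qed.

(** Multiples of $e_0$ lie in every Hurwitz algebra and commute and associate with all octonions,
    which makes the witnesses uniform in $\mathcal{C}$. *)
Definition smat (A : imx) : mat3 F :=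
  [ffun p : 'I_3 * 'I_3 => (ient A p.1 p.2)%:~R *: e ord0].

Lemma mmul_smatl A (x : mat3 F) (p : 'I_3 * 'I_3) :
  mmul (smat A) x p = \sum_(k < 3) (ient A p.1 k)%:~R *: x (k, p.2).
Proof. by rewrite ffunE; apply: eq_bigr => k _; rewrite ffunE omulZl. Qed.

Lemma mmul_smatr A (x : mat3 F) (p : 'I_3 * 'I_3) :
  mmul x (smat A) p = \sum_(k < 3) (ient A k p.2)%:~R *: x (p.1, k).
Proof. by rewrite ffunE; apply: eq_bigr => k _; rewrite ffunE omulZr. Qed.

(** Octonion matrices do not associate in general, but they do once one factor is scalar, be it the
    left one (here), the middle one or the right one (below). *)
Lemma mmul_smatAl A (x y : mat3 F) :
  mmul (mmul (smat A) x) y = mmul (smat A) (mmul x y).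
Proof.
apply/ffunP => p; rewrite mmul_smatl ffunE.
under eq_bigr => l _.
  rewrite mmul_smatl (lin_sum _ (@omul_linear_l F _)).
  under eq_bigr => k _ do rewrite (linear_Z _ _ (@omul_linear_l F _)).
  over.
rewrite exchange_big; apply: eq_bigr => k _.
by rewrite ffunE scaler_sumr.
Qed.

Lemma mmul_smatAm A (x y : mat3 F) :
  mmul (mmul x (smat A)) y = mmul x (mmul (smat A) y).
Proof.
apply/ffunP => p; rewrite !ffunE.
under eq_bigr => l _.
  rewrite mmul_smatr (lin_sum _ (@omul_linear_l F _)).
  under eq_bigr => k _ do rewrite (linear_Z _ _ (@omul_linear_l F _)).
  over.
rewrite exchange_big; apply: eq_bigr => k _.
rewrite mmul_smatl (lin_sum _ (@omul_linear_r F _)).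
by apply: eq_bigr => l _; rewrite (linear_Z _ _ (@omul_linear_r F _)).
Qed.

Lemma mmul_smatAr A (x y : mat3 F) :
  mmul (mmul x y) (smat A) = mmul x (mmul y (smat A)).
Proof.
apply/ffunP => p; rewrite mmul_smatr [RHS]ffunE.
under [RHS]eq_bigr => l _.
  rewrite mmul_smatr (lin_sum _ (@omul_linear_r F _)).
  under eq_bigr => k _ do rewrite (linear_Z _ _ (@omul_linear_r F _)).
  over.
rewrite exchange_big; apply: eq_bigr => k _.
by rewrite ffunE scaler_sumr.
Qed.

Lemma smat_mul A B : smat (imul A B) = mmul (smat A) (smat B).
Proof.
apply/ffunP => p; rewrite mmul_smatl ffunE ient_imk !big_ord_recl big_ord0 addr0.
by rewrite !ffunE !scalerA -!scalerDl addrA !rmorphD !rmorphM.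
Qed.

Lemma smat_sub A B : smat (isub A B) = smat A - smat B.
Proof. by apply/ffunP => p; rewrite !ffunE ient_imk rmorphB scalerBl. Qed.

Lemma smat_add A B : smat (iadd A B) = smat A + smat B.
Proof. by apply/ffunP => p; rewrite !ffunE ient_imk rmorphD scalerDl. Qed.

Lemma smat_scale c A : smat (iscale c A) = c%:~R *: smat A.
Proof. by apply/ffunP => p; rewrite !ffunE ient_imk rmorphM scalerA. Qed.

Lemma mtr_smat A : mtr (smat A) = (itr A)%:~R.
Proof.
rewrite /mtr !big_ord_recl big_ord0 !ffunE !mxE !eqxx /= !mulr1 addr0.
by rewrite /itr !rmorphD addrA.
Qed.

Lemma oconjZ1 (c : F) : oconj (c *: e ord0) = c *: e ord0.
Proof.
apply/rowP => i; rewrite !mxE eqxx; case: eqP => //= _.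
by rewrite mulr0 oppr0.
Qed.

Lemma mconjt_smat A : mconjt (smat A) = smat (itrans A).
Proof. by apply/ffunP => p; rewrite !ffunE oconjZ1 ient_imk. Qed.

End Octonions.

(** * Sums and homogeneous components in the Tits space *)

Section TitsSpace.
Variables (F : fieldType) (C : {vspace oct F}).

Lemma is_derD (V : vectType F) (m : V -> V -> V) (d d' : 'End(V)) :
  (forall a, linear (m a)) -> (forall b, linear (m^~ b)) ->
  is_der m d -> is_der m d' -> is_der m (d + d').
Proof.
move=> mr ml hd hd' a b; rewrite !add_lfunE hd hd'.
have -> : m (d a + d' a) b = m (d a) b + m (d' a) b.
  by have := ml b 1 (d a) (d' a); rewrite !scale1r.
have -> : m a (d b + d' b) = m a (d b) + m a (d' b).
  by have := mr a 1 (d b) (d' b); rewrite !scale1r.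
exact: addrACA.
Qed.

Lemma is_der0 (V : vectType F) (m : V -> V -> V) :
  (forall a, linear (m a)) -> (forall b, linear (m^~ b)) ->
  is_der m (0 : 'End(V)).
Proof.
by move=> mr ml a b; rewrite !zero_lfunE (linear_0 (mr a)) (linear_0 (ml b)) addr0.
Qed.

Lemma jmul_linear_l (u : jalg C) : linear ((@jmul F C)^~ u).
Proof. by move=> c x y; rewrite !(jmulC _ u) jmul_linear. Qed.

(** Closure under sums serves the polarisation in [br_anti]. *)
Lemma titsD (x y : titsA C) : tits x -> tits y -> tits (x + y).
Proof.
move=> [x1 [s hs xs] x3] [y1 [r hr yr] y3]; split=> /=.
- exact: is_derD (@omul_linear_r F) (@omul_linear_l F) x1 y1.
- exists (s ++ r); last by rewrite big_cat xs yr.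
  by move=> p; rewrite mem_cat => /orP[/hs | /hr].
- exact: is_derD (@jmul_linear F C) jmul_linear_l x3 y3.
Qed.

Lemma tits_comp_tits (i : 'I_8) (x : titsA C) : tits_comp i x -> tits x.
Proof.
have d0 := is_der0 (@omul_linear_r F) (@omul_linear_l F).
have D0 := is_der0 (@jmul_linear F C) jmul_linear_l.
rewrite /tits_comp; case: (eqVneq i ord0) => [_ [D hD ->] | ni [d [u [[hd _] tu ->]]]].
  by split=> //; exists [::]; rewrite ?big_nil.
split=> //; exists [:: (e i, u)]; last by rewrite big_seq1.
move=> p; rewrite inE => /eqP ->; split=> //.
by rewrite /otr !mxE eqxx [ord0 == i]eq_sym (negbTE ni) addr0.
Qed.

End TitsSpace.

(** * Integer matrices as elements of $\mathcal{J}$ and of $\mathfrak{der}(\mathcal{J})$ *)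

Section Embedding.
Variables (F : fieldType) (C : {vspace oct F}).
Hypotheses (charF0 : [pchar F] =i pred0) (hC : hurwitz C).
Implicit Types (A B : imx) (u v : jalg C).

Lemma intr_eq0F (z : int) : (z%:~R == 0 :> F) = (z == 0).
Proof.
case: z => n; first exact: (pcharf0P F).1.
by rewrite NegzE rmorphN oppr_eq0; exact: ((pcharf0P F).1 charF0 n.+1).
Qed.

Lemma natr_neq0F n : n.+1%:R != 0 :> F.
Proof. by rewrite ((pcharf0P F).1 charF0). Qed.

Lemma smat_over A p : smat F A p \in C.
Proof.
by case: (hurwitz_span hC) => X [h0 -> _]; rewrite ffunE memvZ // memv_span ?map_f.
Qed.

Lemma smat_hermitian A : symm A -> smat F A \in Defs.hermitian C.
Proof.
move=> sA; apply/hermitianP; split=> [p|]; first exact: smat_over.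
by rewrite mconjt_smat sA smat_scale scale1r.
Qed.

(** The projection makes this total and linear in [A]; for symmetric [A] it only retypes the matrix,
    by [jmatK]. *)
Definition jmat A : jalg C := vsproj (Defs.hermitian C) (smat F A).

Lemma jmatK A : symm A -> vsval (jmat A) = smat F A.
Proof. by move=> sA; rewrite vsprojK // smat_hermitian. Qed.

Definition mad A (x : mat3 F) : mat3 F := mmul (smat F A) x - mmul x (smat F A).

Definition jad A : 'End(jalg C) :=
  linfun (fun u => vsproj (Defs.hermitian C) (mad A (vsval u))).

Lemma vsvalZ c u : vsval (c *: u) = c *: vsval u.
Proof. exact: linearZ. Qed.

Lemma vsvalB u v : vsval (u - v) = vsval u - vsval v.
Proof. exact: linearB. Qed.

Lemma mad_linear A : linear (mad A).
Proof.
move=> c x y; rewrite /mad mmul_linear_r mmul_linear_l opprD addrACA.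
by rewrite scalerBr.
Qed.

Lemma mmul_in (x y : mat3 F) :
  (forall p, x p \in C) -> (forall p, y p \in C) -> forall p, mmul x y p \in C.
Proof.
by move=> hx hy p; rewrite ffunE; apply: memv_suml => k _; exact: omul_span.
Qed.

(** Conjugate transposition reverses products and negates the skew matrix [A]; the two effects
    cancel in the commutator. *)
Lemma mad_hermitian A u : skew A -> mad A (vsval u) \in Defs.hermitian C.
Proof.
move=> kA; have [hu hu'] := hermitianP _ _ (subvsP u).
have mB (x y : mat3 F) : mconjt (x - y) = mconjt x - mconjt y.
  by have := mconjt_linear (-1) y x; rewrite !scaleN1r ![- _ + _]addrC.
apply/hermitianP; split=> [p|].
  by rewrite !ffunE; apply: memvB; apply: memv_suml => k _;
     apply: omul_span => //; exact: smat_over.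
rewrite /mad mB !mmul_conjt hu' mconjt_smat kA smat_scale rmorphN rmorph1.
by rewrite scaleN1r -scaleN1r mmulZl mmulZr !scaleN1r opprK addrC.
Qed.

Lemma jadE A u : skew A -> vsval (jad A u) = mad A (vsval u).
Proof.
move=> kA; rewrite linfunP ?vsprojK ?mad_hermitian // => c x y.
by rewrite linearP mad_linear linearP.
Qed.

(** All associators involving the scalar matrix [A] vanish, so the commutator with [A] obeys the
    Leibniz rule even over the octonions. *)
Lemma jad_der A : skew A -> is_der (@jmul F C) (jad A).
Proof.
move=> kA u v; apply: subvs_inj; rewrite linearD /= (jadE _ kA) !jmulE // !jadE //.
set x := vsval u; set y := vsval v; rewrite (linear_Z _ _ (mad_linear A)) -scalerDr.
congr (_ *: _); rewrite /mad !(mmulDr, mmulDl, mmulNl, mmulNr).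
rewrite !mmul_smatAl !mmul_smatAr !mmul_smatAm.
(* Only six distinct products remain; the identity is linear in them and is checked
   coordinatewise. *)
set a := mmul _ (mmul x y); set b := mmul _ (mmul y x).
set c := mmul x (mmul y _); set d := mmul y (mmul x _).
set f := mmul x (mmul _ y); set g := mmul y (mmul _ x).
clearbody a b c d f g; apply/ffunP => p; apply/rowP => i; rewrite !ffunE !mxE.
move: (a p 0 i) (b p 0 i) (c p 0 i) (d p 0 i) (f p 0 i) (g p 0 i) => *; ring.
Qed.

Lemma jad_jmat A B : skew A -> symm B ->
  jad A (jmat B) = jmat (isub (imul A B) (imul B A)).
Proof.
move=> kA sB; rewrite linfunP; last by move=> c x y; rewrite linearP mad_linear linearP.
by rewrite jmatK // /jmat /mad smat_sub !smat_mul.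
Qed.

Lemma lie_jad A B : skew A -> skew B ->
  lie_end (jad A) (jad B) = jad (isub (imul A B) (imul B A)).
Proof.
move=> kA kB; apply/lfunP => u; apply: subvs_inj.
have [kAB _] := icomm_ianti_sym (or_intror erefl) kA kB.
rewrite lie_endE vsvalB !jadE //.
set x := vsval u; rewrite /mad smat_sub !smat_mul.
rewrite !(mmulDl, mmulDr, mmulNl, mmulNr) !mmul_smatAl !mmul_smatAr.
rewrite !opprD !opprK.
set a := mmul _ (mmul _ x); set b := mmul _ (mmul _ x).
set c := mmul _ (mmul x _); set d := mmul _ (mmul x _).
set f := mmul x _; set g := mmul x _.
clearbody a b c d f g; apply/ffunP => p; apply/rowP => i; rewrite !ffunE !mxE.
move: (a p 0 i) (b p 0 i) (c p 0 i) (d p 0 i) (f p 0 i) (g p 0 i) => *; ring.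
Qed.

Lemma jmul_jmat A B : symm A -> symm B ->
  jmul (jmat A) (jmat B) = 2%:R^-1 *: jmat (iadd (imul A B) (imul B A)).
Proof.
by move=> sA sB; rewrite /jmul !jmatK // -!smat_mul -smat_add linearZ.
Qed.

Lemma jtr_jmat A : symm A -> jtr (jmat A) = (itr A)%:~R.
Proof. by move=> sA; rewrite /jtr jmatK // mtr_smat. Qed.

Lemma jtr_jmul A B : symm A -> symm B ->
  jtr (jmul (jmat A) (jmat B)) = (itr (imul A B))%:~R.
Proof.
move=> sA sB; rewrite jmul_jmat // (linear_Z _ _ (@jtr_linear F C)) jtr_jmat.
  rewrite itrD (itr_mulC B) rmorphD.
  have half (z : F) : 2%:R^-1 * (z + z) = z.
    by rewrite -mulr2n -[z *+ 2]mulr_natl mulKf ?natr_neq0F.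
  exact: half.
by have [_ ->] := icomm_ianti_sym (or_introl erefl) sA sB.
Qed.

Lemma jstar_jmat A B : symm A -> symm B -> itr (imul A B) = 0 ->
  jstar (jmat A) (jmat B) = 2%:R^-1 *: jmat (iadd (imul A B) (imul B A)).
Proof.
move=> sA sB t0; rewrite /jstar jtr_jmul // t0 mulr0 scale0r subr0.
exact: jmul_jmat.
Qed.

Lemma lie_RopE u v w :
  let x := vsval u in let y := vsval v in let z := vsval w in
  vsval (lie_end (Rop u) (Rop v) w) =
  4%:R^-1 *: (mmul (mmul z y + mmul y z) x + mmul x (mmul z y + mmul y z)
              - (mmul (mmul z x + mmul x z) y + mmul y (mmul z x + mmul x z))).
Proof.
rewrite /= lie_endE vsvalB !RopE !jmulE // !mmulZl !mmulZr -!scalerDr !scalerA.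
by rewrite -scalerBr -invfM -natrM.
Qed.

(** In the expansion of $[R_A, R_B](w)$ the mixed terms $AwB$ and $BwA$ cancel, which leaves a
    quarter of the commutator of $[A,B]$ with $w$. *)
Lemma lie_Rop_jmat A B : symm A -> symm B ->
  lie_end (Rop (jmat A)) (Rop (jmat B)) =
  4%:R^-1 *: jad (isub (imul A B) (imul B A)).
Proof.
move=> sA sB; have [kAB _] := icomm_ianti_sym (or_introl erefl) sA sB.
apply/lfunP => u; apply: subvs_inj.
rewrite scale_lfunE vsvalZ lie_RopE (jadE u kAB) (jmatK sA) (jmatK sB).
congr (_ *: _); set x := vsval u; rewrite /mad smat_sub !smat_mul.
rewrite !(mmulDl, mmulDr, mmulNl, mmulNr) !mmul_smatAl !mmul_smatAr !opprD.
set a := mmul _ (mmul _ x); set b := mmul _ (mmul _ x).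
set c := mmul _ (mmul x _); set d := mmul _ (mmul x _).
set f := mmul x _; set g := mmul x _.
clearbody a b c d f g; apply/ffunP => p; apply/rowP => i; rewrite !ffunE !mxE.
move: (a p 0 i) (b p 0 i) (c p 0 i) (d p 0 i) (f p 0 i) (g p 0 i) => *; ring.
Qed.

Lemma jmat_scale c A : jmat (iscale c A) = c%:~R *: jmat A.
Proof. by rewrite /jmat smat_scale linearZ. Qed.

Lemma jmat_subC A B : jmat (isub A B) = - jmat (isub B A).
Proof. by rewrite /jmat !smat_sub -linearN opprB. Qed.

Lemma jad_scale c A : jad (iscale c A) = c%:~R *: jad A.
Proof.
have lin D : linear (fun u : jalg C => vsproj (Defs.hermitian C) (mad D (vsval u))).
  by move=> d x y; rewrite linearP mad_linear linearP.
apply/lfunP => u; rewrite scale_lfunE !linfunP //.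
by rewrite /mad smat_scale mmulZl mmulZr -scalerBr linearZ.
Qed.

(** * Homogeneous elements of the Tits algebra attached to integer matrices *)

Lemma lie_end0 (W : vectType F) (f : 'End(W)) : lie_end 0 f = 0.
Proof. exact: linear_0 (lie_end_linear_l f). Qed.
Lemma lie_end0r (W : vectType F) (f : 'End(W)) : lie_end f 0 = 0.
Proof. exact: linear_0 (lie_end_linear_r f). Qed.
Lemma jmulr0 u : jmul u 0 = 0.
Proof. exact: linear_0 (jmul_linear u). Qed.
Lemma jstarr0 u : jstar u 0 = 0.
Proof. exact: linear_0 (jstar_linear u). Qed.
Lemma jtr0 : jtr (0 : jalg C) = 0.
Proof. exact: linear_0 (@jtr_linear F C). Qed.
Lemma Rop0 : Rop (0 : jalg C) = 0.
Proof. exact: linear_0 (@Rop_linear F C). Qed.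
Lemma tensr0 (V : vectType F) (a : oct F) : tens a (0 : V) = 0.
Proof. exact: linear_0 (tens_linear_r a). Qed.
Lemma tens0r (V : vectType F) (u : V) : tens (0 : oct F) u = 0.
Proof. exact: linear_0 (tens_linear_l u). Qed.

Lemma tensN (V : vectType F) (a : oct F) (u : V) : tens a (- u) = - tens a u.
Proof. by rewrite -scaleN1r (linear_Z _ _ (tens_linear_r _)) scaleN1r. Qed.
Lemma jmul0r u : jmul 0 u = 0.
Proof. by rewrite jmulC jmulr0. Qed.
Lemma jstar0r u : jstar 0 u = 0.
Proof. by rewrite jstarC jstarr0. Qed.

Let zeros := (lie_end0, lie_end0r, jmul0r, jmulr0, jstar0r, jstarr0, jtr0, Rop0).
Let zero_tens := (tensr0, tens0r, zero_lfunE).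
Let zero_mod := (mulr0, scale0r, scaler0, addr0, add0r, subr0, oppr0).

(** One formula for all degrees: at [ord0] the tensor part is switched off, since $e_0$ is not in
    $\mathcal{O}_0$, and [A] acts through its commutator instead. *)
Definition phi (i : 'I_8) A : titsA C :=
  (0, tens (e i) (if i == ord0 then 0 else jmat A),
   if i == ord0 then jad A else 0).

Lemma phi_scale i c A : phi i (iscale c A) = c%:~R *: phi i A.
Proof.
rewrite /phi jad_scale jmat_scale; case: eqP => _; congr (_, _, _);
  by rewrite ?tensr0 ?scaler0 ?(linear_Z _ _ (tens_linear_r _)).
Qed.

Lemma tbracket_phi (i j : 'I_8) A B : ibr_ok i j A B ->
  tbracket (phi i A) (phi j B) = phi (star i j) (ibr i j A B).
Proof.
have n0 (k : 'I_8) : (nat_of_ord k == 0)%N = (k == ord0) by [].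
rewrite /ibr_ok /imx_deg /ibr /skewdeg /phi tbracketE !n0 [(_ == _ :> nat)]val_eqE.
case/and3P => /andP[/eqP + _] /andP[/eqP + _].
rewrite !zeros !zero_tens !zero_mod.
have [-> | ni] := eqVneq i ord0; have [-> | nj] := eqVneq j ord0 => /= sA sB hc.
- rewrite starii eqxx !linear0 !zeros !zero_tens !zero_mod.
  by rewrite jad_scale scale1r lie_jad.
- rewrite star0i (negbTE nj) !zeros !zero_tens !zero_mod.
  by rewrite jmat_scale scale1r jad_jmat.
- rewrite starC star0i (negbTE ni) !zeros !zero_tens !zero_mod.
  rewrite jad_jmat // jmat_subC jmat_scale /isign orbT scale1r.
  by rewrite tensN opprK.
move: hc => /eqP tAB.
rewrite jtr_jmul // tAB !zero_mod lie_Rop_jmat // jstar_jmat // /ocomm !omul_e.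
have [ij | nij] := eqVneq i j.
  rewrite ij starii eqxx subrr !zeros !zero_tens !zero_mod.
  (* Here $2\,t(e_j^2) = -4$ meets the factor $1/4$ of [lie_Rop_jmat], which gives the sign $-1$. *)
  congr (_, _, _); rewrite jad_scale scalerA; congr (_ *: _).
  have -> : isign j j = -1 by rewrite /isign n0 (negbTE nj) eqxx.
  rewrite /emul (negbTE nj) eqxx /otr !mxE eqxx /=.
  by field; rewrite !natr_neq0F.
have ns : star i j != ord0.
  apply: contra nij => /eqP s0; apply/eqP/(bij_inj gel_bij).
  by have := starE i j; rewrite s0 -(starii j) -starE => /addIr.
have sN : isign j i = - isign i j.
  rewrite /isign -!val_star (starC j) !n0 (negbTE ni) (negbTE nj) /=.
  by rewrite ![(_ == _ :> nat)]val_eqE [j == i]eq_sym (negbTE nij) opprB.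
rewrite (negbTE ns) !zeros !zero_tens !zero_mod !emulE // sN (starC j).
have -> : otr ((isign i j)%:~R *: e (star i j)) = 0 :> F.
  by rewrite /otr !mxE eqxx [ord0 == _]eq_sym (negbTE ns) mulr0 addr0.
(* Anticommuting units give $[e_i,e_j] = 2 e_i e_j$, and this 2 cancels the $1/2$ of
   [jstar_jmat]. *)
rewrite !zero_mod -scalerBl -rmorphB opprK jmat_scale.
rewrite !(linear_Z _ _ (tens_linear_r _)) (linear_Z _ _ (tens_linear_l _)).
rewrite scalerA; congr (_, _ *: _, _); rewrite rmorphD /=; field.
exact: natr_neq0F.
Qed.

Lemma phi_comp (i : 'I_8) A : imx_deg i A -> tits_comp i (phi i A).
Proof.
case/andP => /eqP + /eqP tA; rewrite /tits_comp /phi.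
rewrite (_ : (nat_of_ord i == 0)%N = (i == ord0)) //; case: eqP => [-> | ni] sA.
  by exists (jad A); [exact: jad_der | rewrite tensr0].
exists 0, (jmat A); split=> //; last by rewrite jtr_jmat // tA.
split=> [a b | j]; last by exists 0; rewrite zero_lfunE scale0r.
rewrite !zero_lfunE (linear_0 (omul_linear_r _)).
by rewrite (linear_0 (@omul_linear_l F _)) addr0.
Qed.

Lemma smat_eq0 A : smat F A = 0 -> forall p q : 'I_3, ient A p q = 0.
Proof.
move=> /ffunP s0 p q; move: (s0 (p, q)); rewrite !ffunE => /rowP /(_ ord0).
by rewrite !mxE !eqxx mulr1 => /eqP; rewrite intr_eq0F // => /eqP.
Qed.

(** In degree $g_0$ only the operator [jad A] is available: its value on a diagonal matrix with
    distinct entries recovers the off-diagonal part of [A], and skewness kills the diagonal. In the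
    other degrees, coordinate [i] of the tensor is the matrix itself. *)
Lemma phi_eq0 (i : 'I_8) A : imx_deg i A -> phi i A = 0 ->
  forall p q : 'I_3, ient A p q = 0.
Proof.
case/andP => /eqP + _; rewrite (_ : (nat_of_ord i == 0)%N = (i == ord0)) // /phi.
case: eqP => _ sA h0; last first.
  have /ffunP/(_ i) := congr1 (fun x : titsA C => x.1.2) h0.
  rewrite !ffunE mxE !eqxx scale1r => j0; apply: smat_eq0.
  by rewrite -(jmatK sA) // j0 linear0.
have /= D0 := congr1 (fun x : titsA C => x.2) h0.
(* The (p, q) entry of [A, D] is (q - p) A_pq. *)
pose D := idiag 0 1 2.
have sD : symm D by [].
have c0 : smat F (isub (imul A D) (imul D A)) = 0.
  have := jadE (jmat D) sA.
  by rewrite D0 zero_lfunE linear0 jmatK // smat_sub !smat_mul.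
move=> p q; have := smat_eq0 c0 p q; rewrite !ient_imk => cpq.
have : ient A p q * (q%:Z - p%:Z) = 0.
  rewrite -[RHS]cpq; clear cpq.
  by case: p q => [[|[|[|p]]] // ?] [[|[|[|q]]] // ?]; rewrite /D /idiag /ient /=; ring.
move/eqP; rewrite mulf_eq0 => /orP[/eqP // | ]; rewrite subr_eq0 => /eqP [] qp.
have := imk_inj sA (ltn_ord p) (ltn_ord p); rewrite (val_inj qp); lia.
Qed.

(** * The contracted bracket and the resulting identities for [eps] *)

Variables (eps : Z2cube -> Z2cube -> F) (br : titsA C -> titsA C -> titsA C).
Hypothesis br_lie : lie_bracket_on (@tits F C) br.
Hypothesis br_eps : forall (i j : 'I_8) x y, tits_comp i x -> tits_comp j y ->
  br x y = eps (gel i) (gel j) *: tbracket x y.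

Lemma br_anti x y : tits x -> tits y -> br x y = - br y x.
Proof.
case: br_lie => _ lin alt _ hx hy; have hxy := titsD hx hy.
have := alt _ hxy; have [+ _] := lin 1 x y (x + y) hx hy hxy; rewrite !scale1r => ->.
have [_ +] := lin 1 x y x hx hy hx; rewrite !scale1r => ->.
have [_ +] := lin 1 x y y hx hy hy; rewrite !scale1r => ->.
by rewrite !alt // add0r addr0 => /eqP; rewrite addr_eq0 => /eqP.
Qed.

Lemma brZr c x y : tits x -> tits y -> br x (c *: y) = c *: br x y.
Proof.
case: br_lie => _ lin _ _ hx hy.
(* The linearity axiom concerns combinations of two elements of the algebra, so $cy$ is written as
   $(c-1)y + y$. *)
have [_] := lin (c - 1) y y x hy hy hx.
rewrite -[X in _ + X]scale1r -scalerDl subrK.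
by rewrite -[X in _ = _ + X]scale1r -scalerDl subrK.
Qed.

Lemma tits_phi (i : 'I_8) A : imx_deg i A -> tits (phi i A).
Proof. by move=> hA; apply/tits_comp_tits/phi_comp. Qed.

Lemma br_phi (i j : 'I_8) A B : ibr_ok i j A B ->
  br (phi i A) (phi j B) =
  eps (gel i) (gel j) *: phi (star i j) (ibr i j A B).
Proof.
move=> h; have /and3P[hA hB _] := h.
by rewrite (br_eps (phi_comp hA) (phi_comp hB)) tbracket_phi.
Qed.

Lemma br_br_phi (i j k : 'I_8) A B D :
  ibr_ok j k B D -> ibr_ok i (nstar j k) A (ibr j k B D) ->
  br (phi i A) (br (phi j B) (phi k D)) =
  eps3 eps (gel i) (gel j) (gel k) *:
    phi (star i (star j k)) (ibr i (nstar j k) A (ibr j k B D)).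
Proof.
rewrite -val_star => hBD hA; have /and3P[hA' hBD' _] := hA.
rewrite br_phi // brZr; try exact: tits_phi.
by rewrite br_phi // scalerA /eps3 starE mulrC.
Qed.

(** [ibr] always returns a list built by [imk], so vanishing entries force the literal list [izero]
    that [witness_ok] compares with. *)
Lemma ibr_eq0 (i m n : 'I_8) A B : imx_deg m (ibr i n A B) ->
  phi m (ibr i n A B) = 0 -> ibr i n A B = izero.
Proof.
move=> h /(phi_eq0 h) h0.
by apply: imk_eq0 => p q; have := h0 p q; rewrite ient_imk.
Qed.

Lemma witness_ok_ord (i j k : 'I_8) : witness_ok i j k.
Proof.
have ho (l : 'I_8) : nat_of_ord l \in iota 0 8 by rewrite mem_iota /= add0n ltn_ord.
exact: (allP (allP (allP witness_ok_all _ (ho i)) _ (ho j)) _ (ho k)).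
Qed.

Lemma eps_sym (g h : Z2cube) : eps g h = eps h g.
Proof.
have [gi _ giK] := gel_bij; rewrite -(giK g) -(giK h).
move: (gi g) (gi h) => j k.
(* Only the bracket of the second and third witnesses matters here; the first degree is arbitrary
   and is set to [j]. *)
have /and5P[cjk ckj /eqP a_jk /eqP nz _] := witness_ok_ord j j k.
have /and3P[hB hD _] := cjk.
have := br_anti (tits_phi hB) (tits_phi hD).
rewrite !br_phi // a_jk phi_scale // [star k j]starC rmorphN rmorph1 scaleN1r.
rewrite scalerN opprK => /eqP; rewrite -subr_eq0 -scalerBl scaler_eq0 subr_eq0.
move=> /orP[/eqP // | /eqP p0].
have /and5P[_ _ _ _ /andP[cA _]] := witness_ok_ord j j k; case/and3P: cA => _ + _.
by rewrite -val_star => /ibr_eq0/(_ p0) z; rewrite z in nz.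
Qed.

Lemma eps3_rot (g h l : Z2cube) : eps3 eps g h l = eps3 eps h l g.
Proof.
have [gi _ giK] := gel_bij; rewrite -(giK g) -(giK h) -(giK l).
move: (gi g) (gi h) (gi l) => i j k.
have /and5P[cjk _ _ _] := witness_ok_ord i j k.
case/and3P=> cijk adm3 /and5P[nz cki cjki /eqP anti comm].
have /and3P[hB hD _] := cjk; have /and3P[_ hA _] := cki.
(* The inner contracted bracket is zero: for distinct degrees it is a multiple of a vanishing
   bracket, and for equal degrees the two elements coincide. *)
have br0 : br (phi k (wz k)) (br (phi i (wx i j)) (phi j (wy i j))) = 0.
  have tD := tits_phi hD.
  suff -> : br (phi i (wx i j)) (phi j (wy i j)) = 0.
    by rewrite -[X in br _ X](scale0r (phi k (wz k))) brZr // scale0r.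
  have [ij | nij] := eqVneq i j.
    have <- : phi i (wx i j) = phi j (wy i j).
      by rewrite /wx /wy ij eqxx; case: (nat_of_ord j == 0)%N.
    by case: br_lie => _ _ -> //; exact: tits_phi.
  have nij' : (nat_of_ord i != j) by [].
  move: comm; rewrite nij' => /andP[cij /eqP z].
  rewrite br_phi // z (_ : izero = iscale 0 izero) // phi_scale //.
  by rewrite scale0r scaler0.
case: br_lie => _ _ _ jac.
have := jac _ _ _ (tits_phi hA) (tits_phi hB) (tits_phi hD).
(* In the model the second double bracket is minus the first, so the Jacobi identity becomes a
   difference of two [eps3] values times one vector. *)
rewrite [X in _ + X = _]br0 addr0 [X in X + _](br_br_phi cjk cijk).
rewrite [X in _ + X](br_br_phi cki cjki) [X in _ + _ *: phi _ X]anti.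
rewrite [X in _ + _ *: X](phi_scale _ (-1)) rmorphN rmorph1 scaleN1r scalerN.
rewrite [star j (star k i)]starA [star (star j k) i]starC -scalerBl => /eqP.
rewrite scaler_eq0 subr_eq0 => /orP[/eqP // | /eqP p0].
move: nz; rewrite -[nstar j k]val_star in adm3 p0 *; rewrite -val_star in adm3.
by rewrite (ibr_eq0 adm3 p0) eqxx.
Qed.

End Embedding.

Unset Implicit Arguments.

Theorem proposition3p3 (F : closedFieldType) (charF0 : [pchar F] =i pred0)
    (C : {vspace oct F}) (hC : hurwitz C) (eps : Z2cube -> Z2cube -> F) :
  graded_contraction C eps -> generic_graded_contraction eps.
Proof.
case=> br [br_lie br_eps] g h k; split.
  exact: (eps_sym charF0 hC br_lie br_eps).
(* The rotation required is the inverse of the one in [eps3_rot], which is therefore used at (k, g,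
   h) and read backwards. *)
exact/esym/(eps3_rot charF0 hC br_lie br_eps).
Qed.
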